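(* Let $n \geq 3$, let $G = C_{n,n}$ be the $n$-crown graph on vertex set $\{x_1,\ldots,x_n,y_1,\ldots,y_n\}$, and let $J(G) \subset S = \mathbb{K}[x_1,\ldots,x_n,y_1,\ldots,y_n]$ be its cover ideal, where $\mathbb{K}$ is a field. Then for all $s \geq 1$, $$H\left(\frac{S}{J(G)^s},t\right) = \frac{\displaystyle\sum_{i=0}^{ns-1}(i+1)t^i + \sum_{i=0}^{n-3}(n-i-1)s\,t^{ns+i} - (n-1)s\,t^{ns+n-2} - \sum_{i=0}^{s-2}(i+1)n\,t^{s(2n-2)-i(n-2)}}{(1-t)^{2n-2}}.$$
   Context: The crown graph $C_{n,n}$ is the bipartite graph on $\{x_1,\ldots,x_n,y_1,\ldots,y_n\}$ with edge set $\{\{x_i,y_j\} : 1 \leq i,j \leq n,\ i \neq j\}$. Vertices of a graph are identified with the variables of the standard graded polynomial ring $S$. The cover ideal of a graph $G$ is $J(G) = \left(\prod_{x \in w} x \mid w \text{ a minimal vertex cover of } G\right) \subset S$; equivalently $J(G) = \bigcap_{\{u,v\} \in E(G)} (u,v)$. For a finitely generated graded $S$-module $N = \bigoplus_{k \in \mathbb{N}} N_k$, the Hilbert series is $H(N,t) = \sum_{k \in \mathbb{N}} \dim_{\mathbb{K}}(N_k)\,t^k$. Empty sums are $0$. *)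

(* Defs.v *)
From HB Require Import structures.
From mathcomp Require Import all_boot all_order all_algebra.
From mathcomp Require Import mpoly.
From Stdlib Require Import Classical ClassicalEpsilon.

Set Implicit Arguments.
Unset Strict Implicit.
Unset Printing Implicit Defensive.

Import GRing.Theory.
Local Open Scope ring_scope.

Definition ideal_gen (A : comNzRingType) (B : A -> Prop) : A -> Prop :=
  fun p => exists (m : nat) (c g : 'I_m -> A),
    (forall i, B (g i)) /\ p = \sum_(i < m) c i * g i.

Definition ideal_mul (A : comNzRingType) (I J : A -> Prop) : A -> Prop :=
  ideal_gen (fun p => exists a b, [/\ I a, J b & p = a * b]).

Fixpoint ideal_exp (A : comNzRingType) (I : A -> Prop) (s : nat) : A -> Prop :=
  if s is s'.+1 then ideal_mul I (ideal_exp I s') else fun _ => True.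

(* The vertex i of a graph on 'I_m is identified with the variable 'X_i.      *)
Definition vertex_cover (m : nat) (e : rel 'I_m) : pred {set 'I_m} :=
  fun w => [forall u, forall v, e u v ==> (u \in w) || (v \in w)].

Definition cover_ideal (K : fieldType) (m : nat) (e : rel 'I_m) :
    {mpoly K[m]} -> Prop :=
  ideal_gen (fun p => exists2 w : {set 'I_m},
    minset (vertex_cover e) w & p = \prod_(x in w) 'X_x).

(* x_i is the vertex [lshift n i] and y_j is the vertex [rshift n j].         *)
Definition crown (n : nat) : rel 'I_(n + n) := fun u v =>
  match split u, split v with
  | inl i, inr j | inr j, inl i => i != j
  | _, _ => false
  end.

(* Dimension of (W + I) / I, for subspaces W and I of V: the classes of the   *)
(* e_i modulo I form a basis of the image of W in V / I. By [dim_modE] the    *)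
(* size d is unique, and by [hilbert_basis_exists] a finite basis exists in   *)
(* the case of homogeneous components, so [epsilon] never falls back on an    *)
(* arbitrary value there.                                                     *)

Definition basis_mod (K : fieldType) (V : lmodType K) (W I : V -> Prop)
    (d : nat) (e : 'I_d -> V) : Prop :=
  [/\ forall i, W (e i),
      forall c : 'I_d -> K, I (\sum_i c i *: e i) -> forall i, c i = 0
    & forall v, W v -> exists c : 'I_d -> K, I (v - \sum_i c i *: e i)].

Definition dim_mod (K : fieldType) (V : lmodType K) (W I : V -> Prop) : nat :=
  epsilon (inhabits 0%N)
    (fun d => exists e : 'I_d -> V, basis_mod W I e).

(* Coefficient k is the dimension of (S / I)_k, the image in S / I of the     *)
(* homogeneous polynomials of degree k.                                       *)
Definition hilbert_series (K : fieldType) (m : nat)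
    (I : {mpoly K[m]} -> Prop) : nat -> int :=
  fun k => (dim_mod (fun p : {mpoly K[m]} => p \is k.-homog) I)%:Z.

(* A formal power series over int is its sequence nat -> int of coefficients. *)
Definition series_of_poly (p : {poly int}) : nat -> int := fun k => p`_k.

Definition series_mul (F G : nat -> int) : nat -> int :=
  fun k => \sum_(i < k.+1) F i * G (k - i)%N.

(* F = p / q in the domain of formal power series, denominators cleared.      *)
Definition series_eq_frac (F : nat -> int) (p q : {poly int}) : Prop :=
  q != 0 /\ series_mul (series_of_poly q) F =1 series_of_poly p.

Definition linear_pred (K : fieldType) (V : lmodType K) (I : V -> Prop) :=
  I 0 /\ forall (a : K) u v, I u -> I v -> I (a *: u + v).

Section Dimension.
Variables (K : fieldType) (V : lmodType K) (W I : V -> Prop).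
Hypothesis linI : linear_pred I.

Lemma linear_predD u v : I u -> I v -> I (u + v).
Proof. by case: linI => _ H Iu Iv; rewrite -[u]scale1r; apply: H. Qed.

Lemma linear_predZ a u : I u -> I (a *: u).
Proof. by case: linI => I0 H Iu; rewrite -[_ *: _]addr0; apply: H. Qed.

Lemma linear_pred_sum d (F : 'I_d -> V) : (forall i, I (F i)) -> I (\sum_i F i).
Proof.
move=> IF; apply: big_ind => //; first by case: linI.
exact: linear_predD.
Qed.

Lemma basis_mod_exists N (f : 'I_N -> V) :
  (forall i, W (f i)) ->
  (forall v, W v -> exists c : 'I_N -> K, I (v - \sum_i c i *: f i)) ->
  exists d (e : 'I_d -> V), basis_mod W I e.
Proof.
elim: N f => [|N IHN] f Wf spanf; first by exists 0%N, f; split=> // c _ [].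
have [indf|] := excluded_middle_informative
  (forall c : 'I_N.+1 -> K, I (\sum_i c i *: f i) -> forall i, c i = 0).
  by exists N.+1, f.
move=> /not_all_ex_not nind; case: nind => c nc.
have [Ic ni] := imply_to_and _ _ nc.
have [i0 /eqP ci0] := not_all_ex_not _ _ ni.
apply: (IHN (f \o lift i0)) => [i|v /spanf[b Ib]] /=; first exact: Wf.
pose a := b i0 / c i0.
exists (fun i => b (lift i0 i) - a * c (lift i0 i)).
have := linear_predD Ib (linear_predZ a Ic).
rewrite (_ : _ + _ = v - \sum_(i < N) (b (lift i0 i) - a * c (lift i0 i)) *:
   f (lift i0 i)) //.
rewrite scaler_sumr -addrA -sumrN -big_split -sumrN /=; congr (_ + _).
rewrite (bigD1_ord i0) //= scalerA /a divfK // addNr add0r.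
by apply: eq_bigr => i _; rewrite scalerBl scalerA opprB addrC.
Qed.

Lemma basis_mod_leq d d' (e : 'I_d -> V) (f : 'I_d' -> V) :
  basis_mod W I e -> basis_mod W I f -> (d' <= d)%N.
Proof.
move=> [_ _ spane] [Wf indf _]; rewrite leqNgt; apply/negP => lt_dd'.
have Af j : {c : 'I_d -> K | I (f j - \sum_i c i *: e i)}.
  exact/constructive_indefinite_description/spane/Wf.
pose A := \matrix_(j < d', i < d) sval (Af j) i.
have : kermx A != 0.
  rewrite -mxrank_eq0 mxrank_ker subn_eq0 -ltnNge.
  exact: leq_ltn_trans (rank_leq_col A) lt_dd'.
move/rowV0Pn=> [u /sub_kermxP uA0]; apply/negP; rewrite negbK.
apply/eqP/rowP=> j; rewrite mxE; apply: (indf (u 0)) => {j}.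
have := @linear_pred_sum _ (fun j => u 0 j *: (f j - \sum_i sval (Af j) i *: e i)).
rewrite (eq_bigr (fun j => u 0 j *: f j - \sum_i (u 0 j * A j i) *: e i)); last first.
  move=> j _; rewrite scalerBr scaler_sumr; congr (_ - _).
  by apply: eq_bigr => i _; rewrite scalerA mxE.
rewrite sumrB exchange_big /= [X in _ - X]big1 ?subr0.
  by apply=> j; apply: linear_predZ; apply: (svalP (Af j)).
move=> i _; rewrite -scaler_suml.
by have /rowP/(_ i) := uA0; rewrite !mxE => ->; rewrite scale0r.
Qed.

Lemma dim_modE d (e : 'I_d -> V) : basis_mod W I e -> dim_mod W I = d.
Proof.
move=> be; have [f bf] : exists f : 'I_(dim_mod W I) -> V, basis_mod W I f.
  exact: (epsilon_spec (inhabits 0%N)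
    (fun d => exists e : 'I_d -> V, basis_mod W I e) (ex_intro _ d (ex_intro _ e be))).
by apply/eqP; rewrite eqn_leq (basis_mod_leq be bf) (basis_mod_leq bf be).
Qed.
End Dimension.

Lemma ideal_gen_linear (K : fieldType) (m : nat) (B : {mpoly K[m]} -> Prop) :
  linear_pred (ideal_gen B).
Proof.
split=> [|a _ _ [p [c [g [Bg ->]]]] [q [c' [g' [Bg' ->]]]]].
  by exists 0%N, (fun _ => 0), (fun _ => 0); rewrite big_ord0; split=> // -[].
exists (p + q)%N,
  (fun i => match split i with inl i => a *: c i | inr i => c' i end),
  (fun i => match split i with inl i => g i | inr i => g' i end).
split=> [i|]; first by case: (split i).
rewrite big_split_ord /= scaler_sumr; congr (_ + _); apply: eq_bigr => i _.
  by rewrite -[lshift q i]/(unsplit (inl i)) unsplitK scalerAl.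
by rewrite -[rshift p i]/(unsplit (inr i)) unsplitK.
Qed.

Lemma ideal_exp_linear (K : fieldType) (m : nat) (I : {mpoly K[m]} -> Prop) s :
  linear_pred (ideal_exp I s).
Proof. by case: s => [|s] //; apply: ideal_gen_linear. Qed.

Lemma hilbert_basis_exists (K : fieldType) (m : nat) (I : {mpoly K[m]} -> Prop)
    (k : nat) : linear_pred I ->
  exists e : 'I_(dim_mod (fun p : {mpoly K[m]} => p \is k.-homog) I) -> _,
    basis_mod (fun p : {mpoly K[m]} => p \is k.-homog) I e.
Proof.
move=> linI; apply: (epsilon_spec (inhabits 0%N) (fun d => exists e : 'I_d -> {mpoly K[m]},
  basis_mod (fun p : {mpoly K[m]} => p \is k.-homog) I e)).
pose M : finType := bmultinom m k.+1.
pose f (i : 'I_#|{: M}|) : {mpoly K[m]} :=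
  if mdeg (enum_val i : M) == k then 'X_[enum_val i] else 0.
apply: (@basis_mod_exists _ _ _ _ linI _ f) => [i|v hv].
  by rewrite /f; case: ifP => [d|_]; rewrite ?dhomogX ?rpred0.
exists (fun i => v@_(enum_val i : M)).
suff <- : v = \sum_i v@_(enum_val i : M) *: f i by rewrite subrr; case: linI.
have szv : (msize v <= k.+1)%N.
  rewrite msizeE; apply/bigmax_leqP_seq => t tv _.
  by rewrite (dhomogP _ _ _ hv t tv).
rewrite {1}(mpolywE szv) (reindex _ (onW_bij _ (@enum_val_bij M))) /=.
apply: eq_bigr => i _; rewrite /f; case: eqP => // /eqP ne.
by rewrite (dhomog_nemf_coeff hv ne) !scale0r.
Qed.

(* Main.v *)
(* A monomial x^a y^b lies in J^s iff a_i + b_j >= s for all i <> j: it is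
   divisible by x_1...x_n (divide, and s drops by one), or by y_1...y_n
   (likewise), or else there is exactly one i with a_i = b_i = 0 and all the
   other exponents are at least s, so that it is divisible by the s-th power of
   the generator omitting x_i and y_i.

   The same case distinction counts these monomials. With F_s their generating
   series, inclusion-exclusion on the two sides gives
     F_s = 2 t^n F_(s-1) - t^(2n) F_(s-2) + n t^(s(2n-2)) / (1-t)^(2n-2),
   where F_(-1) stands for F_0 = 1/(1-t)^(2n). Hence the numerators
   N_s = (1-t)^(2n-2) (F_0 - F_s) satisfy N_0 = 0 and
     N_s = 2 t^n N_(s-1) - t^(2n) N_(s-2) + b_s,
     b_s = (1 + t + ... + t^(n-1))^2 - n t^(s(2n-2)),
   so that N_s = sum_(i < s) (i+1) t^(n i) b_(s-i). *)

Require Import Defs.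
From HB Require Import structures.
From mathcomp Require Import all_boot all_order all_algebra.
From mathcomp Require Import mpoly zify ring.

Set Implicit Arguments.
Unset Strict Implicit.
Unset Printing Implicit Defensive.

Import GRing.Theory.
Local Open Scope ring_scope.

(** * Counting monomials by degree; truncated generating series *)

Definition monoms (N k : nat) : seq 'X_{1..N} :=
  [seq m <- map val (enum {: 'X_{1..N < k.+1}}) | mdeg m == k].

Lemma mem_monoms N k (m : 'X_{1..N}) : (m \in monoms N k) = (mdeg m == k).
Proof.
rewrite mem_filter andb_idr // => /eqP mk.
have lt_mk : (mdeg m < k.+1)%N by rewrite mk.
by apply/mapP; exists (BMultinom lt_mk); rewrite ?mem_enum.
Qed.

Lemma uniq_monoms N k : uniq (monoms N k).
Proof. by rewrite filter_uniq // map_inj_uniq ?enum_uniq //; apply: val_inj. Qed.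

Definition nmonoms N (Q : pred 'X_{1..N}) (k : nat) : nat := count Q (monoms N k).

(** Multiplication by [u] maps the monomials of degree [k - mdeg u] bijectively onto the multiples
    of [u] of degree [k]. The case [k < mdeg u] is separate because the subtraction then truncates
    to [0]. *)
Lemma nmonoms_shift N (Q : pred 'X_{1..N}) (u : 'X_{1..N}) k :
  nmonoms (fun m => (u <= m)%MM && Q (m - u)%MM) k =
  if (k < mdeg u)%N then 0%N else nmonoms Q (k - mdeg u)%N.
Proof.
case: ltnP => [lt_ku|le_uk].
  rewrite /nmonoms -(count_pred0 (monoms N k)); apply: eq_in_count => m.
  rewrite mem_monoms => /eqP mk; apply/negbTE/negP => /andP[/submK eq_m _].
  by move: lt_ku; rewrite -mk -eq_m mdegD; lia.
rewrite /nmonoms.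
have /permP/(_ (fun m => Q (m - u)%MM)) : perm_eq
    [seq m <- monoms N k | (u <= m)%MM]
    [seq (m + u)%MM | m <- monoms N (k - mdeg u)].
  apply: uniq_perm; first by rewrite filter_uniq ?uniq_monoms.
    by rewrite map_inj_uniq ?uniq_monoms //; apply: addIm.
  move=> m; rewrite mem_filter mem_monoms.
  apply/andP/mapP => [[/submK eq_m /eqP mk]|[m' + ->]].
    exists (m - u)%MM; rewrite ?eq_m // mem_monoms.
    by rewrite -mk -[in X in _ == X]eq_m mdegD addnK.
  by rewrite mem_monoms => /eqP mk'; rewrite lem_addl mdegD mk' subnK.
rewrite count_filter count_map => cQ; transitivity (count
  (preim (fun m => (m + u)%MM) (fun m => Q (m - u)%MM)) (monoms N (k - mdeg u))).
  by rewrite -cQ; apply: eq_count => m /=; rewrite andbC.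
by apply: eq_count => m /=; rewrite addmK.
Qed.

Definition gser K N (Q : pred 'X_{1..N}) : {poly int} :=
  \poly_(k < K) (nmonoms Q k)%:Z.

Lemma eq_gser K N (Q R : pred 'X_{1..N}) : Q =1 R -> gser K Q = gser K R.
Proof.
by move=> eqQR; apply: eq_poly => k _; congr Posz; apply: eq_count.
Qed.

Lemma gserID K N (R Q : pred 'X_{1..N}) :
  gser K Q = gser K (fun m => Q m && R m) + gser K (fun m => Q m && ~~ R m).
Proof.
apply/polyP => k; rewrite coefD !coef_poly; case: ifP => // _.
rewrite -PoszD /nmonoms; congr Posz.
by elim: (monoms N k) => //= m r ->; case: (Q m); case: (R m); lia.
Qed.

Lemma gserC K N (Q : pred 'X_{1..N}) :
  gser K (fun m => ~~ Q m) = gser K (fun _ : 'X_{1..N} => true) - gser K Q.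
Proof. by rewrite (gserID K Q (fun _ => true)) addrAC subrr add0r. Qed.

Lemma gser_sum K N (I : finType) (Q : pred 'X_{1..N}) (P : I -> pred 'X_{1..N}) :
    (forall m, Q m = [exists i, P i m]) ->
    (forall m i j, P i m -> P j m -> i = j) ->
  gser K Q = \sum_i gser K (P i).
Proof.
move=> QP Pinj; apply/polyP => k; rewrite coef_sum coef_poly.
under eq_bigr do rewrite coef_poly.
case: ifP => _; last by rewrite big1.
rewrite -(big_morph Posz PoszD (erefl (Posz 0))); congr Posz.
under eq_bigr do rewrite /nmonoms -sum1_count big_mkcond.
rewrite /nmonoms -sum1_count big_mkcond exchange_big /=; apply: eq_bigr => m _.
rewrite QP; case: existsP => [[i Pim]|nP]; last first.
  by rewrite big1 // => i _; case: ifP => // Pim; case: nP; exists i.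
rewrite (bigD1 i) //= Pim big1 // => j ne_ji; case: ifP => // Pjm.
by rewrite (Pinj _ _ _ Pjm Pim) eqxx in ne_ji.
Qed.

(* Power series identities are stated for truncated series, modulo 'X^K. *)
Definition vanish (K : nat) (p : {poly int}) := forall k, (k < K)%N -> p`_k = 0.

Lemma vanish0 K : vanish K 0.
Proof. by move=> k _; rewrite coef0. Qed.

Lemma vanishD K p q : vanish K p -> vanish K q -> vanish K (p + q).
Proof. by move=> vp vq k ltk; rewrite coefD vp ?vq. Qed.

Lemma vanishMl K p q : vanish K q -> vanish K (p * q).
Proof.
move=> vq k ltk; rewrite coefM big1 // => i _.
by rewrite vq ?mulr0 //; apply: leq_ltn_trans ltk; apply: leq_subr.
Qed.

Lemma vanishN K p : vanish K p -> vanish K (- p).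
Proof. by move=> vp k ltk; rewrite coefN vp ?oppr0. Qed.

(** Equality is claimed only below degree [K]: the product with ['X^(mdeg u)] may also have terms
    beyond the truncation. *)
Lemma gser_shift K N (Q : pred 'X_{1..N}) (u : 'X_{1..N}) :
  vanish K (gser K (fun m => (u <= m)%MM && Q (m - u)%MM)
            - 'X^(mdeg u) * gser K Q).
Proof.
move=> k ltk; rewrite coefB coefXnM !coef_poly ltk nmonoms_shift.
case: ltnP => _; first by rewrite subrr.
by rewrite (leq_ltn_trans (leq_subr _ _) ltk) subrr.
Qed.

Definition supported N (V : {set 'I_N}) (m : 'X_{1..N}) : bool :=
  [forall x, (x \notin V) ==> (m x == 0%N)].

(** This is the Hilbert series [1 / (1 - t)^#|V|] of a polynomial ring on [V]. Induction removes a
    variable [x]: the multiples of [x] are a shift of the whole series, the other monomials are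
    supported on [V :\ x]. *)
Lemma gser_supported K N (V : {set 'I_N}) :
  vanish K ((1 - 'X) ^+ #|V| * gser K (supported V) - 1).
Proof.
have [c] := ubnP #|V|; elim: c V => // c IHc V ltVc.
have [->|[x Vx]] := set_0Vmem V.
  rewrite cards0 mul1r => k ltk; rewrite coefB coef_poly ltk coef1.
  rewrite (_ : nmonoms _ _ = (k == 0)%N) ?natz ?subrr //.
  have eq0 m : supported (@set0 'I_N) m = (m == 0%MM).
    apply/forallP/eqP => [sm|-> x]; last by rewrite mnm0E implybT.
    apply/mnmP => x; rewrite mnm0E.
    by have := sm x; rewrite inE => /eqP.
  rewrite /nmonoms (eq_count eq0) count_uniq_mem ?uniq_monoms // mem_monoms.
  by rewrite mdeg0 eq_sym.
rewrite (cardsD1 x) Vx exprS.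
have := IHc (V :\ x).
rewrite (cardsD1 x) Vx in ltVc => /(_ ltVc) vIH.
have sh := @gser_shift K N (supported V) U_(x)%MM; rewrite mdeg1 expr1 in sh.
have eqV : gser K (supported V) =
    gser K (fun m => (U_(x) <= m)%MM && supported V (m - U_(x))%MM)
    + gser K (supported (V :\ x)).
  rewrite (gserID K (fun m => (U_(x) <= m)%MM)); congr (_ + _); apply: eq_gser => m.
    rewrite andbC; case: (boolP (_ <= m)%MM) => //= _.
    apply: eq_forallb => y; rewrite mnmBE mnm1E.
    have [<-|_] := eqVneq x y; first by rewrite Vx.
    by rewrite subn0.
  rewrite lep1mP negbK; apply/andP/forallP => [[/forallP sm mx] y|sm].
    by rewrite !inE negb_and negbK; have [->|_] := eqVneq y x; rewrite ?mx //=.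
  split; last by have := sm x; rewrite !inE eqxx.
  apply/forallP => y; apply/implyP => nVy; have := sm y.
  by rewrite !inE (negbTE nVy) andbF.
set g := gser K (supported V) in sh eqV *.
have {}eqV := canRL (addKr _) (esym eqV); rewrite eqV in vIH.
have := vanishD (vanishMl ((1 - 'X) ^+ #|V :\ x|) sh) vIH.
by congr vanish; ring.
Qed.

(** * Identities for geometric and arithmetico-geometric sums *)

Section NumeratorIdentities.
Variables (R : comNzRingType) (x : R).

Definition geom n : R := \sum_(i < n) x ^+ i.
Definition arith_geom n : R := \sum_(i < n) i.+1%:R * x ^+ i.

Lemma geomM n : (1 - x) * geom n = 1 - x ^+ n.
Proof.
elim: n => [|n IHn]; first by rewrite /geom big_ord0 mulr0 expr0 subrr.
by rewrite /geom big_ord_recr mulrDr [_ * _]IHn /= exprS; ring.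
Qed.

Lemma arith_geomM n : (1 - x) * arith_geom n = geom n - n%:R * x ^+ n.
Proof.
elim: n => [|n IHn]; first by rewrite /geom /arith_geom !big_ord0 mul0r subrr mulr0.
rewrite /geom /arith_geom !big_ord_recr mulrDr.
by rewrite [_ * \sum_(_ < _) _]IHn /= /geom exprS -natr1; ring.
Qed.

(** The coefficients of the square climb [1, ..., n], then descend [n - 1, ..., 0]; the bracket on
    the right is the descending half. *)
Lemma geom_sqr n : geom n ^+ 2 = arith_geom n + x ^+ n * (n%:R * geom n - arith_geom n).
Proof.
elim: n => [|n IHn]; first by rewrite /geom /arith_geom !big_ord0; ring.
have gE : geom n.+1 = geom n + x ^+ n by rewrite /geom big_ord_recr.
have aE : arith_geom n.+1 = arith_geom n + n.+1%:R * x ^+ n.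
  by rewrite /arith_geom big_ord_recr.
rewrite gE aE sqrrD IHn (exprS x) -natr1.
transitivity (arith_geom n + x ^+ n * (n%:R * geom n - arith_geom n)
  + x ^+ n * (2 * geom n + x ^+ n)).
  by ring.
(* [1 - x] may be a zero divisor in [R], so nothing is cancelled: [geomM] and [arith_geomM] become
   rules for multiplication by [x]. *)
have xG : x * geom n = geom n - 1 + x ^+ n.
  by transitivity (geom n - (1 - x) * geom n); [ring | rewrite geomM; ring].
have xA : x * arith_geom n = arith_geom n - geom n + n%:R * x ^+ n.
  by transitivity (arith_geom n - (1 - x) * arith_geom n);
    [ring | rewrite arith_geomM; ring].
transitivity (arith_geom n + (n%:R + 1) * x ^+ n
  + x ^+ n * ((n%:R + 1) * (x * geom n) - x * arith_geom n)); last by ring.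
by rewrite xG xA; ring.
Qed.

(** In degree [n * i + j] with [j < n], the ascending half of block [i] gives [(i + 1) * (j + 1)]
    and the descending half of block [i - 1] gives [i * (n - 1 - j)], in total [n * i + j + 1]. Only
    the descending half of the last block is left over. *)
Lemma geom_sqr_arith_geom n s :
  geom n ^+ 2 * (\sum_(i < s) i.+1%:R * x ^+ (n * i)) =
  arith_geom (n * s) + s%:R * x ^+ (n * s) * (n%:R * geom n - arith_geom n).
Proof.
elim: s => [|s IHs]; first by rewrite muln0 /arith_geom !big_ord0; ring.
rewrite big_ord_recr mulrDr IHs /= geom_sqr mulnS addnC.
have -> : arith_geom (n * s + n) =
    arith_geom (n * s) + x ^+ (n * s) * ((n * s)%:R * geom n + arith_geom n).
  rewrite {1}/arith_geom big_split_ord /=; congr (_ + _).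
  rewrite /geom /arith_geom mulr_sumr -big_split mulr_sumr /=; apply: eq_bigr => i _.
  by rewrite exprD -addnS natrD; ring.
by rewrite exprD natrM -natr1; ring.
Qed.
End NumeratorIdentities.

(** * Monomial ideals and powers of cover ideals *)

(** The hypotheses make [I] the span of the monomials in [Q], so the degree [k] monomials outside
    [Q] give a basis of the quotient. *)
Lemma dim_mod_monomial (K : fieldType) N (I : {mpoly K[N]} -> Prop)
    (Q : pred 'X_{1..N}) k :
    linear_pred I -> (forall m, Q m -> I 'X_[m]) ->
    (forall p, I p -> {in msupp p, forall m, Q m}) ->
  dim_mod (fun p : {mpoly K[N]} => p \is k.-homog) I
    = nmonoms (fun m => ~~ Q m) k.
Proof.
move=> linI QI IQ; rewrite /nmonoms -size_filter.
set l := [seq m <- _ | _].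
have ul : uniq l by rewrite filter_uniq ?uniq_monoms.
have lP m : (m \in l) = ~~ Q m && (mdeg m == k).
  by rewrite mem_filter mem_monoms.
apply: (dim_modE linI (e := fun i : 'I_(size l) => 'X_[nth 0%MM l i])).
split=> [i|c Ic i|v hv].
- by rewrite dhomogX; have := mem_nth 0%MM (ltn_ord i); rewrite lP => /andP[].
- apply/eqP/negPn/negP => ci; have := mem_nth 0%MM (ltn_ord i).
  rewrite lP => /andP[/negP nQ _]; apply: nQ; apply: (IQ _ Ic).
  rewrite mcoeff_msupp raddf_sum (bigD1 i) //= mcoeffZ mcoeffX eqxx mulr1.
  rewrite big1 ?addr0 // => j ne_ji; rewrite mcoeffZ mcoeffX nth_uniq //.
  by rewrite (negbTE (_ : nat_of_ord j != i)) ?mulr0.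
- exists (fun i => v@_(nth 0%MM l i)).
  rewrite -(big_mkord xpredT (fun i => v@_(nth 0%MM l i) *: 'X_[nth 0%MM l i])).
  rewrite -(big_nth 0%MM xpredT (fun m => v@_m *: 'X_[m])) big_filter.
  have vE : v = \sum_(m <- monoms N k) v@_m *: 'X_[m].
    apply/mpolyP => m; rewrite raddf_sum /=.
    have [mk|nmk] := boolP (m \in monoms N k); last first.
      rewrite big_seq big1 => [|m' m'k]; last first.
        rewrite mcoeffZ mcoeffX; case: eqP m'k nmk => [-> -> //|_ _ _].
        by rewrite mulr0.
      by apply: (dhomog_nemf_coeff hv); rewrite -mem_monoms.
    rewrite (bigD1_seq m) ?uniq_monoms //= mcoeffZ mcoeffX eqxx mulr1.
    rewrite big1 ?addr0 // => m' ne_m'm.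
    by rewrite mcoeffZ mcoeffX (negbTE ne_m'm) mulr0.
  rewrite {1}vE (bigID Q) /= addrK.
  apply: big_ind => [|p q|m Qm]; first by case: linI.
    exact: linear_predD.
  exact: linear_predZ (QI m Qm).
Qed.

(* The exponents of the monomials in the intersection of the ideals
   ('X_u, 'X_v)^s over the edges, which contains the s-th power of the cover
   ideal. *)
Definition covers N (e : rel 'I_N) (s : nat) (m : 'X_{1..N}) : bool :=
  [forall u, forall v, e u v ==> (s <= m u + m v)%N].

Lemma coversP N (e : rel 'I_N) s (m : 'X_{1..N}) :
  reflect (forall u v, e u v -> (s <= m u + m v)%N) (covers e s m).
Proof.
apply: (iffP forallP) => sm u; last by apply/forallP => v; apply/implyP/sm.
by move=> v; apply/implyP; move: v; apply/forallP.
Qed.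

Lemma coversD N (e : rel 'I_N) s t (m m' : 'X_{1..N}) :
  covers e s m -> covers e t m' -> covers e (s + t) (m + m').
Proof.
move=> /coversP sm /coversP tm'; apply/coversP => u v euv.
by rewrite !mnmDE; have := sm u v euv; have := tm' u v euv; lia.
Qed.

Lemma msupp_ideal_gen (K : fieldType) N (Q : pred 'X_{1..N}) (B : {mpoly K[N]} -> Prop) :
    (forall m m', Q m -> Q (m' + m)%MM) ->
    (forall g, B g -> {in msupp g, forall m, Q m}) ->
  forall p, ideal_gen B p -> {in msupp p, forall m, Q m}.
Proof.
move=> Qup QB p [d [c [g [Bg ->]]]] m /msupp_sum_le/flattenP[_ /mapP[i _ ->]].
by move=> /msuppM_le/allpairsP[[m1 m2] [/= _ /(QB _ (Bg i)) Qm2 ->]]; apply: Qup.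
Qed.

Lemma mpolyX_mesym1 (K : fieldType) N (w : {set 'I_N}) :
  \prod_(x in w) 'X_x = 'X_[mesym1 w] :> {mpoly K[N]}.
Proof.
rewrite mprodXE; congr 'X_[_]; apply/mnmP => i; rewrite mnm_sumE mnmE.
have [iw|niw] := boolP (i \in w).
  rewrite (bigD1 i) //= mnm1E eqxx big1 // => j /andP[_ ne_ji].
  by rewrite mnm1E (negbTE ne_ji).
by rewrite big1 // => j jw; rewrite mnm1E; case: eqP jw niw => // -> ->.
Qed.

(** One vertex cover contributes at least one on each edge, and these contributions add up in
    products by [coversD]. This inclusion holds for every graph; the reverse one for the crown graph
    is [mpolyX_cover_exp]. *)
Lemma msupp_cover_exp (K : fieldType) N (e : rel 'I_N) s (p : {mpoly K[N]}) :
  ideal_exp (@cover_ideal K N e) s p -> {in msupp p, forall m, covers e s m}.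
Proof.
have cov0 m : covers e 0 m by apply/coversP.
have up t m m' : covers e t m -> covers e t (m' + m).
  by move=> tm; rewrite -[t]add0n; apply: coversD.
elim: s p => [|s IHs] p; first by move=> _ m _.
apply: msupp_ideal_gen => [m m'|_ [a [b [Ja Jb ->]]]]; first exact: up.
move=> _ /msuppM_le/allpairsP[[m1 m2] [/= am1 /(IHs _ Jb) cm2 ->]].
rewrite -add1n; apply: coversD => //; move: am1; move: m1; apply: msupp_ideal_gen Ja.
  exact: up.
move=> _ [w /minsetp wc ->] m; rewrite mpolyX_mesym1 msuppX inE => /eqP->.
apply/coversP => u v euv; rewrite !mnmE addn_gt0 !lt0b.
by have /forallP/(_ u)/forallP/(_ v)/implyP/(_ euv) := wc.
Qed.

Lemma ideal_gen_incl (K : fieldType) N (B : {mpoly K[N]} -> Prop) p c :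
  B p -> ideal_gen B (c * p).
Proof.
by move=> Bp; exists 1%N, (fun=> c), (fun=> p); split; rewrite ?big_ord1.
Qed.

(** A cover contains a minimal one, whose monomial divides that of the cover. *)
Lemma cover_ideal_cover (K : fieldType) N (e : rel 'I_N) (w : {set 'I_N}) :
  vertex_cover e w -> @cover_ideal K N e 'X_[mesym1 w].
Proof.
move=> /minset_exists[w' mw' sw'w].
have -> : 'X_[mesym1 w] = 'X_[mesym1 w - mesym1 w'] * 'X_[mesym1 w'] :> {mpoly K[N]}.
  rewrite -mpolyXD submK //; apply/mnm_lepP => i; rewrite !mnmE.
  by case: (boolP (i \in w')) => // /(subsetP sw'w) ->.
by apply: ideal_gen_incl; exists w'; rewrite ?mpolyX_mesym1.
Qed.

Lemma cover_exp_step (K : fieldType) N (e : rel 'I_N) s (w : {set 'I_N}) m :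
    vertex_cover e w -> (mesym1 w <= m)%MM ->
    ideal_exp (@cover_ideal K N e) s 'X_[m - mesym1 w] ->
  ideal_exp (@cover_ideal K N e) s.+1 'X_[m].
Proof.
move=> cw wm Jm; rewrite /= /ideal_mul -[X in ideal_gen _ X]mul1r.
apply: ideal_gen_incl; exists 'X_[mesym1 w], 'X_[m - mesym1 w].
by split=> //; [apply: cover_ideal_cover | rewrite mulrC -mpolyXD submK].
Qed.

Lemma mesym1_leP N (w : {set 'I_N}) (m : 'X_{1..N}) :
  reflect (forall x, x \in w -> (0 < m x)%N) (mesym1 w <= m)%MM.
Proof.
apply: (iffP mnm_lepP) => wm x; have := wm x; rewrite mnmE.
  by case: (x \in w) => // h _.
by case: (x \in w) => // ->.
Qed.

(** * Covering exponents of the crown graph *)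

Section Crown.
Variable n : nat.
Implicit Types (m : 'X_{1..n + n}) (i j : 'I_n) (s : nat).

Definition xside : {set 'I_(n + n)} := [set u : 'I_(n + n) | (u < n)%N].
Definition yside : {set 'I_(n + n)} := ~: xside.
Definition pair_compl i : {set 'I_(n + n)} := ~: [set lshift n i; rshift n i].

Lemma ord_sumP (P : 'I_(n + n) -> Prop) :
  (forall i, P (lshift n i)) -> (forall i, P (rshift n i)) -> forall u, P u.
Proof. by move=> Pl Pr u; rewrite -[u]splitK; case: (split u) => i /=. Qed.

Lemma crown_lr i j : crown (lshift n i) (rshift n j) = (i != j).
Proof.
rewrite /crown -[lshift n i]/(unsplit (inl i)) -[rshift n j]/(unsplit (inr j)).
by rewrite !unsplitK.
Qed.

Lemma crown_rl i j : crown (rshift n j) (lshift n i) = (i != j).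
Proof.
rewrite /crown -[lshift n i]/(unsplit (inl i)) -[rshift n j]/(unsplit (inr j)).
by rewrite !unsplitK.
Qed.

Lemma crown_ll i j : crown (lshift n i) (lshift n j) = false.
Proof.
rewrite /crown -[lshift n i]/(unsplit (inl i)) -[lshift n j]/(unsplit (inl j)).
by rewrite !unsplitK.
Qed.

Lemma crown_rr i j : crown (rshift n i) (rshift n j) = false.
Proof.
rewrite /crown -[rshift n i]/(unsplit (inr i)) -[rshift n j]/(unsplit (inr j)).
by rewrite !unsplitK.
Qed.

(** Serves both the exponent conditions and the vertex covers, each symmetric in the two ends of an
    edge. *)
Lemma crown_edgeP (P : 'I_(n + n) -> 'I_(n + n) -> Prop) :
    (forall u v, P u v -> P v u) ->
  (forall u v, crown u v -> P u v) <->
  (forall i j, i != j -> P (lshift n i) (rshift n j)).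
Proof.
move=> Psym; split=> [Pc i j ne_ij|Pc]; first by apply: Pc; rewrite crown_lr.
apply: ord_sumP => i; apply: ord_sumP => j; rewrite ?crown_ll ?crown_rr //.
  by rewrite crown_lr => /Pc.
by rewrite crown_rl => /Pc/Psym.
Qed.

Lemma crown_coversP s m :
  reflect (forall i j, i != j -> (s <= m (lshift n i) + m (rshift n j))%N)
          (covers (@crown n) s m).
Proof.
have := @crown_edgeP (fun u v => s <= m u + m v)%N.
by case=> [u v|cP Pc]; [rewrite addnC | apply: (iffP (coversP _ _ _))].
Qed.

Lemma crown_vertex_coverP (w : {set 'I_(n + n)}) :
  (forall i j, i != j -> (lshift n i \in w) || (rshift n j \in w)) ->
  vertex_cover (@crown n) w.
Proof.
move=> wP; apply/forallP => u; apply/forallP => v; apply/implyP; move: u v.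
by apply/(@crown_edgeP (fun u v => (u \in w) || (v \in w))) => // u v; rewrite orbC.
Qed.

Lemma mem_xside_l i : lshift n i \in xside.
Proof. by rewrite inE /=. Qed.

Lemma mem_xside_r i : rshift n i \in xside = false.
Proof. by rewrite inE /= ltnNge leq_addr. Qed.

Lemma mem_yside_l i : lshift n i \in yside = false.
Proof. by rewrite inE mem_xside_l. Qed.

Lemma mem_yside_r i : rshift n i \in yside.
Proof. by rewrite inE mem_xside_r. Qed.

Lemma mem_pair_compl_l i j : (lshift n j \in pair_compl i) = (j != i).
Proof. by rewrite !inE eq_lshift eq_lrshift orbF. Qed.

Lemma mem_pair_compl_r i j : (rshift n j \in pair_compl i) = (j != i).
Proof. by rewrite !inE eq_rshift eq_rlshift. Qed.

Definition mem_sidesE := (mem_xside_l, mem_xside_r, mem_yside_l, mem_yside_r,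
  mem_pair_compl_l, mem_pair_compl_r).

Lemma card_xside : #|xside| = n.
Proof.
rewrite -sum1_card big_split_ord /= (eq_bigl xpredT) => [|i]; last by rewrite mem_sidesE.
rewrite sum1_card card_ord big1 ?addn0 // => i.
by rewrite mem_sidesE.
Qed.

Lemma card_yside : #|yside| = n.
Proof. by rewrite cardsCs setCK card_ord card_xside addnK. Qed.

Lemma card_pair_compl i : #|pair_compl i| = (2 * n - 2)%N.
Proof. by rewrite cardsCs setCK card_ord cards2 eq_lrshift; lia. Qed.

Lemma xside_leP m :
  reflect (forall i, 0 < m (lshift n i))%N (mesym1 xside <= m)%MM.
Proof.
apply: (iffP (mesym1_leP _ _)) => xm; first by move=> i; apply: xm; rewrite mem_sidesE.
by apply: ord_sumP => i; rewrite mem_sidesE.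
Qed.

Lemma yside_leP m :
  reflect (forall i, 0 < m (rshift n i))%N (mesym1 yside <= m)%MM.
Proof.
apply: (iffP (mesym1_leP _ _)) => xm; first by move=> i; apply: xm; rewrite mem_sidesE.
by apply: ord_sumP => i; rewrite mem_sidesE.
Qed.

(** Every edge has exactly one end in [xside], so the division lowers each edge sum by exactly one.
    For [s = 0] both sides are trivially true. *)
Lemma covers_sub_xside s m : (mesym1 xside <= m)%MM ->
  covers (@crown n) s m = covers (@crown n) s.-1 (m - mesym1 xside).
Proof.
move=> /xside_leP xm; apply/crown_coversP/crown_coversP => sm i j ne_ij.
  by rewrite !mnmE !mem_sidesE; have := sm i j ne_ij; have := xm i; lia.
by have := sm i j ne_ij; rewrite !mnmE !mem_sidesE; have := xm i; lia.
Qed.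

Lemma covers_sub_yside s m : (mesym1 yside <= m)%MM ->
  covers (@crown n) s m = covers (@crown n) s.-1 (m - mesym1 yside).
Proof.
move=> /yside_leP xm; apply/crown_coversP/crown_coversP => sm i j ne_ij.
  by rewrite !mnmE !mem_sidesE; have := sm i j ne_ij; have := xm j; lia.
by have := sm i j ne_ij; rewrite !mnmE !mem_sidesE; have := xm j; lia.
Qed.

(* A monomial divisible by neither side misses some x_i and some y_j, and
   i = j since otherwise the edge {x_i, y_j} would not be covered. *)
Lemma covers_residual s m : (0 < s)%N ->
  [&& covers (@crown n) s m, ~~ (mesym1 xside <= m)%MM & ~~ (mesym1 yside <= m)%MM]
  = [exists i, (mesym1 (pair_compl i) *+ s <= m)%MM
       && supported (pair_compl i) (m - mesym1 (pair_compl i) *+ s)].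
Proof.
move=> s_gt0; apply/and3P/existsP.
  case=> /crown_coversP sm /xside_leP xm /yside_leP ym.
  have /forallPn[i] : ~~ [forall i, 0 < m (lshift n i)]%N by apply/forallP.
  have /forallPn[j] : ~~ [forall i, 0 < m (rshift n i)]%N by apply/forallP.
  rewrite -!eqn0Ngt => /eqP mj /eqP mi.
  have eq_ij : i = j.
    by apply/eqP; apply: contraLR s_gt0 => /sm; rewrite mi mj -leqNgt.
  rewrite -{j}eq_ij in mj; exists i; apply/andP; split.
    (* For [j != i], the edges {x_j, y_i} and {x_i, y_j} have an end of exponent [0], so the other
       end carries all of [s]. *)
    apply/mnm_lepP; apply: ord_sumP => j; rewrite mulmnE mnmE mem_sidesE.
      by have [->|/sm] := eqVneq j i; rewrite ?mj ?addn0 // mul1n.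
    by have [->|] := eqVneq j i; rewrite // eq_sym => /sm; rewrite mi mul1n.
  apply/forallP; apply: ord_sumP => j; rewrite mem_sidesE negbK; apply/implyP => /eqP->.
    by rewrite mnmBE mi.
  by rewrite mnmBE mj.
case=> i /andP[/mnm_lepP sm /forallP supp].
have mi : m (lshift n i) = 0%N.
  have := supp (lshift n i); rewrite mnmBE mulmnE mnmE mem_sidesE eqxx /=.
  by rewrite subn0 => /eqP.
have mj : m (rshift n i) = 0%N.
  have := supp (rshift n i); rewrite mnmBE mulmnE mnmE mem_sidesE eqxx /=.
  by rewrite subn0 => /eqP.
split.
- apply/crown_coversP => j k ne_jk.
  (* One of [j], [k] differs from [i], and the exponent at that end alone is at least [s]. *)
  have [eq_ji|ne_ji] := eqVneq j i.
    have := sm (rshift n k); rewrite mulmnE mnmE mem_sidesE -eq_ji eq_sym ne_jk; lia.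
  have := sm (lshift n j); rewrite mulmnE mnmE mem_sidesE ne_ji; lia.
- by apply/xside_leP => /(_ i); rewrite mi.
- by apply/yside_leP => /(_ i); rewrite mj.
Qed.

(** Together with [msupp_cover_exp], this shows that ordinary and symbolic powers of the cover ideal
    of the crown graph coincide. *)
Lemma mpolyX_cover_exp (K : fieldType) s m :
  covers (@crown n) s m ->
  ideal_exp (@cover_ideal K (n + n) (@crown n)) s 'X_[m].
Proof.
elim: s m => // s IHs m sm.
have [xm|nxm] := boolP (mesym1 xside <= m)%MM.
  apply: (cover_exp_step _ xm); last by apply: IHs; rewrite -(covers_sub_xside s.+1 xm).
  by apply: crown_vertex_coverP => i j _; rewrite !mem_sidesE.
have [ym|nym] := boolP (mesym1 yside <= m)%MM.
  apply: (cover_exp_step _ ym); last by apply: IHs; rewrite -(covers_sub_yside s.+1 ym).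
  by apply: crown_vertex_coverP => i j _; rewrite !mem_sidesE.
have := @covers_residual s.+1 m isT; rewrite sm nxm nym => /esym/existsP[i].
case/andP=> /mnm_lepP im _.
apply: (@cover_exp_step _ _ _ _ (pair_compl i)); last apply: IHs.
- apply: crown_vertex_coverP => j k; rewrite !mem_sidesE; apply: contra_neqT.
  by rewrite negb_or !negbK => /andP[/eqP-> /eqP].
- apply/mnm_lepP => u; by apply: leq_trans (im u); rewrite mulmnE leq_pmulr.
(* An edge through x_i or y_i loses one, at its other end, of exponent at least [s.+1]. Any other
   edge loses one at each end, but both exponents are at least [s.+1]. *)
- apply/crown_coversP => j k ne_jk; rewrite !mnmBE !mnmE !mem_sidesE.
  have := im (lshift n j); have := im (rshift n k); rewrite !mulmnE !mnmE !mem_sidesE.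
  by have [eq_ji|ne_ji] := eqVneq j i; have [eq_ki|ne_ki] := eqVneq k i;
    try lia; rewrite eq_ji eq_ki eqxx in ne_jk.
Qed.

Definition cover_gser K s := gser K (covers (@crown n) s).

(* For s = 1 the truncation s.-2 = 0 is correct: after division by all the
   variables, no condition is left. *)
Lemma cover_gser_rec K s : (0 < s)%N ->
  vanish K (cover_gser K s
    - (2 * 'X^n * cover_gser K s.-1 - ('X^n) ^+ 2 * cover_gser K s.-2
       + \sum_i 'X^(s * (2 * n - 2)) * gser K (supported (pair_compl i)))).
Proof.
move=> s_gt0; rewrite /cover_gser; set C := covers _.
pose dx m := (mesym1 xside <= m)%MM; pose dy m := (mesym1 yside <= m)%MM.
have ex : vanish K (gser K (fun m => C s m && dx m) - 'X^n * gser K (C s.-1)).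
  have := @gser_shift K _ (C s.-1) (mesym1 xside).
  rewrite mdeg_mesym1 card_xside; congr vanish; congr (_ - _).
  apply: eq_gser => m; rewrite andbC; apply: andb_id2r => xm.
  by rewrite /C (covers_sub_xside s xm).
have ey : vanish K (gser K (fun m => C s m && dy m) - 'X^n * gser K (C s.-1)).
  have := @gser_shift K _ (C s.-1) (mesym1 yside).
  rewrite mdeg_mesym1 card_yside; congr vanish; congr (_ - _).
  apply: eq_gser => m; rewrite andbC; apply: andb_id2r => xm.
  by rewrite /C (covers_sub_yside s xm).
have dxy m : dx m && dy m = (mesym1 xside + mesym1 yside <= m)%MM.
  apply/andP/mnm_lepP => [[/xside_leP xm /yside_leP ym]|xym].
    by apply: ord_sumP => i; rewrite mnmDE !mnmE !mem_sidesE.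
  split; [apply/xside_leP|apply/yside_leP] => i.
    by have := xym (lshift n i); rewrite mnmDE !mnmE !mem_sidesE.
  by have := xym (rshift n i); rewrite mnmDE !mnmE !mem_sidesE.
(* Each side divided out lowers the order by one, hence [s.-2]. *)
have exy : vanish K (gser K (fun m => (C s m && dx m) && dy m)
                     - ('X^n) ^+ 2 * gser K (C s.-2)).
  have := @gser_shift K _ (C s.-2) (mesym1 xside + mesym1 yside)%MM.
  rewrite mdegD !mdeg_mesym1 card_xside card_yside exprD -expr2.
  congr vanish; congr (_ - _); apply: eq_gser => m.
  rewrite -andbA dxy andbC; apply: andb_id2r; rewrite -dxy => /andP[xm ym].
  have {}ym : (mesym1 yside <= m - mesym1 xside)%MM.
    apply/yside_leP => i; have := yside_leP _ ym i.
    by rewrite mnmBE !mnmE mem_sidesE subn0.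
  rewrite /C (covers_sub_xside s xm) (covers_sub_yside _ ym).
  by congr covers; apply/mnmP => u; rewrite !(mnmBE, mnmDE) subnDA.
pose r i m := (mesym1 (pair_compl i) *+ s <= m)%MM
  && supported (pair_compl i) (m - mesym1 (pair_compl i) *+ s).
have er : gser K (fun m => (C s m && ~~ dx m) && ~~ dy m) = \sum_i gser K (r i).
  apply: gser_sum => [m|m i j /andP[im _] /andP[_ /forallP jm]].
    by rewrite -andbA covers_residual.
  apply/eqP/negPn/negP => ne_ij.
  have := jm (lshift n j); have := mnm_lepP im (lshift n j).
  by rewrite mnmBE !mulmnE !mnmE !mem_sidesE eqxx eq_sym ne_ij /=; lia.
have vr : vanish K (\sum_i (gser K (r i)
    - 'X^(s * (2 * n - 2)) * gser K (supported (pair_compl i)))).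
  apply: big_ind => [||i _]; [exact: vanish0 | exact: vanishD |].
  have := @gser_shift K _ (supported (pair_compl i)) (mesym1 (pair_compl i) *+ s)%MM.
  by rewrite mdegMn mdeg_mesym1 card_pair_compl [(_ * s)%N]mulnC.
(* [e1] and [e2] split off the multiples of the x side, then those of the y side among the rest;
   [e3] expresses the latter by inclusion-exclusion. *)
have e1 := gserID K dx (C s).
have e2 := gserID K dy (fun m => C s m && ~~ dx m).
have e3 := gserID K dx (fun m => C s m && dy m).
rewrite (eq_gser K (fun m => andbAC _ _ (dx m))) in e3.
rewrite (eq_gser K (fun m => andbAC _ _ (~~ dx m))) in e3.
have := vanishD (vanishD ex ey) (vanishD (vanishN exy) vr).
congr vanish; rewrite sumrB -er e1 e2 e3; ring.
Qed.
End Crown.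

(** * The numerator: recurrence and closed form *)

Section Numerator.
Variable n : nat.

(** The inhomogeneous term b_k of the recurrence for the numerators N_s, which are
    [hilbert_num s]. *)
Definition hilbert_num_step k : {poly int} :=
  geom 'X n ^+ 2 - n%:R * 'X^(k * (2 * n - 2)).

Definition hilbert_num s : {poly int} :=
  \sum_(i < s) i.+1%:R * 'X^(n * i) * hilbert_num_step (s - i).

(** The characteristic polynomial is the square [(z - t^n)^2], so the recurrence factors into two of
    first order, through the auxiliary sum [d]. *)
Lemma hilbert_num_rec s :
  hilbert_num s.+1 =
    2 * 'X^n * hilbert_num s - ('X^n) ^+ 2 * hilbert_num s.-1 + hilbert_num_step s.+1.
Proof.
pose d s := \sum_(i < s) 'X^(n * i) * hilbert_num_step (s - i).
have dS t : d t.+1 = 'X^n * d t + hilbert_num_step t.+1.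
  rewrite /d big_ord_recl muln0 mul1r subn0 addrC mulr_sumr; congr (_ + _).
  by apply: eq_bigr => i _; rewrite mulrA -exprD -mulnS subSS.
have numS t : hilbert_num t.+1 = 'X^n * hilbert_num t + d t.+1.
  rewrite dS /hilbert_num /d big_ord_recl muln0 !mul1r subn0 addrC.
  rewrite [RHS]addrA !mulr_sumr -big_split.
  congr (_ + _); apply: eq_bigr => i _ /=.
  by rewrite /bump add1n subSS mulnS exprD -natr1; ring.
(* At [s = 0] the default [0.-1 = 0] is harmless because [hilbert_num 0 = 0]. *)
case: s => [|s]; first by rewrite numS dS /hilbert_num /d !big_ord0; ring.
by rewrite numS dS (canRL (addKr _) (esym (numS s))); ring.
Qed.

(** The squares of [geom] are summed by [geom_sqr_arith_geom]. The top term [s t^(ns+n-2)] of its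
    leftover and the term [- s n t^(ns+n-2)] with [i = s - 1] of the subtracted sum merge into the
    isolated term. *)
Lemma hilbert_num_explicit s : (2 <= n)%N -> (1 <= s)%N ->
  hilbert_num s =
    \sum_(0 <= i < n * s) (i + 1)%:R *: 'X^i
     + \sum_(0 <= i < n - 2) ((n - i - 1) * s)%:R *: 'X^(n * s + i)
     - ((n - 1) * s)%:R *: 'X^(n * s + n - 2)
     - \sum_(0 <= i < s - 1)
         ((i + 1) * n)%:R *: 'X^(s * (2 * n - 2) - i * (n - 2)).
Proof.
move=> n_ge2 s_gt0.
have expE i : (i <= s)%N ->
    (s * (2 * n - 2) - i * (n - 2) = n * i + (s - i) * (2 * n - 2))%N.
  move=> le_is; have [p ->] : {p | n = p.+2} by exists (n - 2)%N; lia.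
  have [t ->] : {t | s = i + t}%N by exists (s - i)%N; lia.
  by rewrite addKn; nia.
have -> : hilbert_num s = geom 'X n ^+ 2 * (\sum_(i < s) i.+1%:R * 'X^(n * i))
    - \sum_(i < s) (i.+1 * n)%:R * 'X^(s * (2 * n - 2) - i * (n - 2)).
  rewrite mulr_sumr -sumrB; apply: eq_bigr => i _.
  rewrite expE 1?ltnW // exprD natrM /hilbert_num_step; ring.
have scaleE k (p : {poly int}) : k%:R *: p = k%:R * p by rewrite scaler_nat mulr_natl.
have geomE : n%:R * geom 'X n - arith_geom 'X n =
    \sum_(0 <= i < n - 2) (n - i - 1)%:R * 'X^i + 'X^(n - 2) :> {poly int}.
  rewrite /geom /arith_geom mulr_sumr -sumrB.
  rewrite -(big_mkord xpredT (fun i => n%:R * 'X^i - i.+1%:R * 'X^i)).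
  transitivity (\sum_(0 <= i < n) (n - i - 1)%:R * 'X^i : {poly int}).
    apply: eq_big_nat => i /andP[_ lt_in].
    by rewrite -mulrBl -natrB // -subnDA addn1.
  (* The coefficient is [0] at [i = n - 1] and [1] at [i = n - 2], which gives the separate power
     ['X^(n - 2)]. *)
  case: n n_ge2 => [|[|p]] // _; rewrite subSS subn1 !big_nat_recr //=.
  by rewrite subSnn subnn subSn // subSnn mul0r mul1r addr0.
rewrite geom_sqr_arith_geom geomE.
have -> : \sum_(0 <= i < n * s) (i + 1)%:R *: 'X^i = arith_geom 'X (n * s) :> {poly int}.
  by rewrite big_mkord; apply: eq_bigr => i _; rewrite scaleE addn1.
have -> : \sum_(0 <= i < n - 2) ((n - i - 1) * s)%:R *: 'X^(n * s + i) =
    s%:R * 'X^(n * s) * (\sum_(0 <= i < n - 2) (n - i - 1)%:R * 'X^i) :> {poly int}.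
  by rewrite mulr_sumr; apply: eq_bigr => i _; rewrite scaleE natrM exprD; ring.
case: s s_gt0 expE => // s _ expE; rewrite subSS subn0 !big_mkord big_ord_recr /=.
under [X in _ = _ - X]eq_bigr do rewrite scaleE addn1.
have -> : (s.+1 * (2 * n - 2) - s * (n - 2) = n * s.+1 + (n - 2))%N.
  by rewrite expE // subSnn mulnS; lia.
rewrite scaleE -addnBA // exprD !natrM natrB; last exact: ltnW.
by ring.
Qed.
End Numerator.

(** Below degree [K] both sides satisfy the same recurrence of order two and vanish at [s = 0]. *)
Lemma hilbert_crown K n s : (1 <= n)%N ->
  vanish K ((1 - 'X) ^+ (2 * n - 2) * gser K (fun m => ~~ covers (@crown n) s m)
            - hilbert_num n s).
Proof.
move=> n_gt0; set P := (1 - 'X) ^+ _.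
pose A := gser K (fun _ : 'X_{1..n + n} => true).
have vA : vanish K (P * (1 - 'X) ^+ 2 * A - 1).
  have := @gser_supported K (n + n) setT.
  rewrite -exprD cardsT card_ord (_ : 2 * n - 2 + 2 = n + n)%N; last by lia.
  congr vanish; congr (_ * _ - _); apply: eq_gser => m.
  by apply/forallP => x; rewrite inE.
have rec t : vanish K (P * gser K (fun m => ~~ covers (@crown n) t.+1 m)
    - (2 * 'X^n * (P * gser K (fun m => ~~ covers (@crown n) t m))
       - ('X^n) ^+ 2 * (P * gser K (fun m => ~~ covers (@crown n) t.-1 m))
       + hilbert_num_step n t.+1)).
  have vR : vanish K (\sum_(i < n) ('X^(t.+1 * (2 * n - 2)) *
      (P * gser K (supported (pair_compl i)) - 1))).
    apply: big_ind => [||i _]; [exact: vanish0 | exact: vanishD |].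
    by apply: vanishMl; have := @gser_supported K _ (pair_compl i);
      rewrite card_pair_compl.
  have vF := vanishMl P (@cover_gser_rec n K t.+1 isT).
  (* Passing to the complement adds [(1 - t^n)^2 P A]. Below degree [K] this is [geom 'X n ^+ 2],
     since [1 - t^n = (1 - t) * geom 'X n] and [P (1 - t)^2 A = 1] there. *)
  have := vanishD (vanishD (vanishN vF) (vanishN vR)) (vanishMl (geom 'X n ^+ 2) vA).
  congr vanish; rewrite !gserC -/A /cover_gser /hilbert_num_step /=.
  rewrite -!mulr_sumr sumrB sumr_const card_ord -mulr_sumr.
  have gX : 'X^n = 1 - (1 - 'X) * geom 'X n :> {poly int} by rewrite geomM subKr.
  rewrite gX; ring.
have base : vanish K (P * gser K (fun m => ~~ covers (@crown n) 0 m) - hilbert_num n 0).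
  rewrite gserC (@eq_gser K _ (covers (@crown n) 0) (fun _ => true)) => [|m];
    last exact/coversP.
  by rewrite subrr mulr0 /hilbert_num big_ord0 subrr; apply: vanish0.
(* The recurrence has order two, so the induction carries two consecutive values. *)
suff [] : vanish K (P * gser K (fun m => ~~ covers (@crown n) s m) - hilbert_num n s) /\
  vanish K (P * gser K (fun m => ~~ covers (@crown n) s.-1 m) - hilbert_num n s.-1) by [].
elim: s => [//|s [v0 v1]]; split=> //; rewrite hilbert_num_rec.
have := vanishD (vanishD (rec s) (vanishMl (2 * 'X^n) v0))
  (vanishMl (- ('X^n) ^+ 2) v1).
by congr vanish; ring.
Qed.

Theorem theorem3p6 (K : fieldType) (n : nat) (hn : (3 <= n)%N)
    (s : nat) (hs : (1 <= s)%N) :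
  series_eq_frac
    (hilbert_series (ideal_exp (@cover_ideal K (n + n) (@crown n)) s))
    (\sum_(0 <= i < n * s) (i + 1)%:R *: 'X^i
     + \sum_(0 <= i < n - 2) ((n - i - 1) * s)%:R *: 'X^(n * s + i)
     - ((n - 1) * s)%:R *: 'X^(n * s + n - 2)
     - \sum_(0 <= i < s - 1)
         ((i + 1) * n)%:R *: 'X^(s * (2 * n - 2) - i * (n - 2)))
    ((1 - 'X) ^+ (2 * n - 2)).
Proof.
split=> [|k].
  by rewrite expf_neq0 // -oppr_eq0 opprB (polyXsubC_eq0 1).
rewrite -hilbert_num_explicit // 1?ltnW //.
have n_gt0 : (0 < n)%N by lia.
(* The coefficient of [t^k] depends only on degrees up to [k], so truncation at [k.+1] loses
   nothing. *)
have /eqP := @hilbert_crown k.+1 n s n_gt0 k (ltnSn k).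
rewrite coefB subr_eq0 /series_of_poly => /eqP <-; rewrite coefM; apply: eq_bigr => i _.
rewrite coef_poly ltnS leq_subr; congr (_ * _); congr Posz.
apply: dim_mod_monomial => [|m|p]; first exact: ideal_exp_linear.
  exact: mpolyX_cover_exp.
exact: msupp_cover_exp.
Qed.
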